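(* Let $0<a<1$, $0<c<1$, let $b$ be complex and let $u>0$ be real. Then $$\frac{1}{2\pi i}\int_{c-i\infty}^{c+i\infty}\frac{\sin\pi(aw-b)}{\sin\pi w}\left(u^{a}\right)^{w}dw=\frac{1}{\pi}\,\frac{u^{a}\sin\pi(a-b)-u^{2a}\sin\pi b}{1+2u^{a}\cos\pi a+u^{2a}},$$ and $$\int_{0}^{\infty}\frac{\cosh\pi at}{\cosh\pi t}\cos(at\log u)\,dt=\frac{u^{\frac a2}\left(1+u^{a}\right)\cos\frac{\pi a}{2}}{1+2u^{a}\cos\pi a+u^{2a}} .$$ *)

(* Defs.v *)
From Stdlib Require Import Reals.
From Coquelicot Require Import Coquelicot.

Local Open Scope C_scope.

Definition Cexp (z : C) : C :=
  (exp (Re z) * cos (Im z), exp (Re z) * sin (Im z))%R.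

Definition Csin (z : C) : C :=
  (Cexp (Ci * z) - Cexp (- (Ci * z))) / (2 * Ci).

(* The power x ^ w with the real logarithm of x; meaningful for 0 < x only. *)
Definition Cpower (x : R) (w : C) : C := Cexp (w * ln x).

(* The integral of f(w) dw along the upward line Re w = c converges to l:
   with w = c + it, dw = i dt, the two limits t -> -oo and t -> +oo being taken
   independently (this is not a principal value). *)
Definition is_vertical_integral (f : C -> C) (c : R) (l : C) : Prop :=
  is_RInt_gen (V := C_R_NormedModule) (fun t : R => f (c + Ci * t) * Ci)
    (Rbar_locally m_infty) (Rbar_locally p_infty) l.

(* Main.v *)
Require Import Defs.
From Stdlib Require Import Reals Lra FunctionalExtensionality.
From Coquelicot Require Import Coquelicot.

(** Expanding the sine into exponentials reduces both formulas to one integral: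
    for complex [l] with [|Im l| < PI], [e^l <> -1] and [0 < c < 1],
    [int_R e^(l (c + it)) / sin (PI (c + it)) dt = 2 e^l / (1 + e^l)]
    ([Cexp_over_Csin_integral]).  The first formula uses [l = a ln u + i PI a]
    and [l = a ln u - i PI a]; the second is the case [c = 1/2], where
    [sin (PI (1/2 + it)) = cosh (PI t)], followed by a halving of the line by parity.

    Write [F] for that integral and [F0] for its value at [l = 0].  Moving the line
    from [Re w = c] to [Re w = c - 1] multiplies [e^(l w) / sin (PI w)] by [-e^(-l)] and
    [1 / sin (PI w)] by [-1].  The difference [(e^(l w) - 1) / sin (PI w)] has a removable
    singularity at [0], so it is holomorphic in [|Re w| < 1], and it decays
    exponentially as [Im w] grows; hence its integral is the same on both lines
    ([regular_quotient_shift_integral]).  This reads [F - F0 = - e^(-l) F + F0], that is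
    [F = 2 F0 / (1 + e^(-l))].  Finally [F0 = 1] by explicit antiderivatives
    ([inv_Csin_integral]): the residue is hidden in the two limits of an arctangent.

    Invariance under translation of the line ([vertical_integral_shift]) comes from
    differentiating a truncated integral under the integral sign: by the Cauchy-Riemann
    equations the derivative is a boundary term.  On the line through the singularity
    only continuity is required, because the mean value theorem is applied on each
    side of it. *)

Local Open Scope R_scope.

(** * Complex exponential and sine in coordinates *)

Lemma C_ext (z w : C) : Re z = Re w -> Im z = Im w -> z = w.
Proof. destruct z, w; simpl; intros; subst; reflexivity. Qed.

Lemma Cexp_plus (z w : C) : Cexp (z + w) = (Cexp z * Cexp w)%C.
Proof.
  destruct z as [x y], w as [x' y']; unfold Cexp; simpl.
  apply C_ext; simpl; rewrite exp_plus; [rewrite cos_plus | rewrite sin_plus]; ring.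
Qed.

Lemma Cexp_0 : Cexp 0 = 1.
Proof. unfold Cexp; simpl. rewrite exp_0, cos_0, sin_0. apply C_ext; simpl; ring. Qed.

Lemma Cexp_neq_0 (z : C) : Cexp z <> 0.
Proof.
  intros H. apply C1_nz. rewrite <- Cexp_0.
  replace (RtoC 0) with (z + - z)%C by ring.
  rewrite Cexp_plus, H. ring.
Qed.

Lemma Cexp_opp (z : C) : Cexp (- z) = (/ Cexp z)%C.
Proof.
  assert (H : (Cexp z * Cexp (- z))%C = 1).
  { rewrite <- Cexp_plus, <- Cexp_0. f_equal. ring. }
  rewrite <- (Cmult_1_r (/ Cexp z)), <- H. field. apply Cexp_neq_0.
Qed.

Lemma Cmod_Cexp (z : C) : Cmod (Cexp z) = exp (Re z).
Proof.
  unfold Cmod, Cexp; simpl.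
  replace (_ + _) with (exp (Re z) ^ 2 * ((sin (Im z))² + (cos (Im z))²))
    by (unfold Rsqr; ring).
  rewrite sin2_cos2, Rmult_1_r. apply sqrt_pow2, Rlt_le, exp_pos.
Qed.

Lemma Csin_coord (x y : R) : Csin (x, y) = (sin x * cosh y, cos x * sinh y).
Proof.
  unfold Csin, Cexp, cosh, sinh; simpl.
  replace (0 * x - 1 * y) with (- y) by ring.
  replace (0 * y + 1 * x) with x by ring.
  rewrite cos_neg, sin_neg, Ropp_involutive.
  apply C_ext; simpl; field.
Qed.

Lemma vertical_coord (c t : R) : (c + Ci * t)%C = (c, t).
Proof. apply C_ext; simpl; ring. Qed.

Lemma real_scale_coord (r x y : R) : (r * (x, y))%C = (r * x, r * y).
Proof. apply C_ext; simpl; ring. Qed.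

Lemma Csin_PI_coord (s t : R) :
  Csin (PI * (s, t)) = (sin (PI * s) * cosh (PI * t), cos (PI * s) * sinh (PI * t)).
Proof. rewrite real_scale_coord. apply Csin_coord. Qed.

Lemma Csin_PI_shift (w : C) : Csin (PI * (w - 1)) = (- Csin (PI * w))%C.
Proof.
  destruct w as [s t].
  replace ((s, t) - 1)%C with (s - 1, t) by (apply C_ext; simpl; ring).
  rewrite !Csin_PI_coord.
  replace (PI * (s - 1)) with (PI * s - PI) by ring.
  rewrite sin_minus, cos_minus, sin_PI, cos_PI.
  apply C_ext; simpl; ring.
Qed.

Lemma cosh_sqr (x : R) : cosh x * cosh x = 1 + sinh x * sinh x.
Proof.
  unfold cosh, sinh. 
  assert (exp x * exp (- x) = 1) by (rewrite <- exp_plus, Rplus_opp_r; apply exp_0).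
  nra.
Qed.

(** [|sin (x + iy)|^2 = sin^2 x + sinh^2 y]: the source of both the location of the zeros
    and the growth of the sine. *)
Lemma Csin_norm (s t : R) :
  Re (Csin (PI * (s, t))) ^ 2 + Im (Csin (PI * (s, t))) ^ 2
  = sin (PI * s) ^ 2 + sinh (PI * t) ^ 2.
Proof.
  rewrite Csin_PI_coord; simpl.
  assert (H := sin2_cos2 (PI * s)). unfold Rsqr in H.
  assert (K := cosh_sqr (PI * t)).
  replace (_ + _) with (sin (PI * s) * sin (PI * s) * (cosh (PI*t) * cosh (PI*t)) +
     (cos (PI*s) * cos (PI * s)) * (sinh (PI * t) * sinh (PI * t))) by ring.
  rewrite K. replace (cos (PI*s) * cos (PI * s)) with (1 - sin (PI*s) * sin (PI * s)) by lra.
  ring.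
Qed.

Lemma sinh_neq_0 (x : R) : x <> 0 -> sinh x <> 0.
Proof.
  intros Hx. destruct (Rdichotomy _ _ Hx) as [H | H];
    apply sinh_lt in H; rewrite sinh_0 in H; lra.
Qed.

Lemma sin_PI_neq_0 (s : R) : -1 < s < 1 -> s <> 0 -> sin (PI * s) <> 0.
Proof.
  intros Hs H0. assert (HP := PI_RGT_0).
  destruct (Rdichotomy _ _ H0) as [H | H].
  - apply Rlt_not_eq, sin_lt_0_var; nra.
  - apply Rgt_not_eq, sin_gt_0; nra.
Qed.

Lemma Csin_PI_neq_0 (w : C) : -1 < Re w < 1 -> w <> 0 -> Csin (PI * w) <> 0.
Proof.
  destruct w as [s t]; simpl; intros Hs Hw E.
  assert (N := Csin_norm s t). rewrite E in N; simpl in N.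
  destruct (Req_dec s 0) as [-> | H0].
  - assert (Ht : t <> 0) by (intros ->; now apply Hw).
    assert (PI * t <> 0) by (apply Rmult_integral_contrapositive_currified; trivial; apply PI_neq0).
    assert (K := sinh_neq_0 _ H). nra.
  - assert (K := sin_PI_neq_0 s Hs H0). nra.
Qed.

Lemma sum_sqr_neq_0 (z : C) : z <> 0 -> Re z ^ 2 + Im z ^ 2 <> 0.
Proof. intros H E. apply H. apply C_ext; simpl; nra. Qed.

(** * Derivatives of complex curves *)

Definition is_derive_curve (f : R -> C) (x : R) (l : C) : Prop :=
  is_derive (fun x => Re (f x)) x (Re l) /\ is_derive (fun x => Im (f x)) x (Im l).

Lemma is_derive_curve_ext_loc f g x l :
  locally x (fun y => f y = g y) -> is_derive_curve f x l -> is_derive_curve g x l.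
Proof.
  intros H [H1 H2]; split.
  - apply is_derive_ext_loc with (2 := H1). revert H. apply filter_imp. now intros y ->.
  - apply is_derive_ext_loc with (2 := H2). revert H. apply filter_imp. now intros y ->.
Qed.

(** The hypotheses are put in terms of four real functions so that the rule becomes an
    identity of real rational functions. *)
Lemma is_derive_curve_div (f g : R -> C) x lf lg :
  is_derive_curve f x lf -> is_derive_curve g x lg -> g x <> 0 ->
  is_derive_curve (fun y => f y / g y)%C x ((lf * g x - f x * lg) / (g x * g x))%C.
Proof.
  intros [F1 F2] [G1 G2] H0.
  assert (HN := sum_sqr_neq_0 _ H0).
  assert (HM := sum_sqr_neq_0 _ (Cmult_neq_0 _ _ H0 H0)).
  assert (E : forall A B X Y : R -> R, forall A' B' X' Y',
    is_derive A x A' -> is_derive B x B' -> is_derive X x X' -> is_derive Y x Y' ->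
    (f = fun y => (A y, B y)) -> (g = fun y => (X y, Y y)) -> lf = (A', B') -> lg = (X', Y') ->
    is_derive_curve (fun y => f y / g y)%C x ((lf * g x - f x * lg) / (g x * g x))%C).
  { clear F1 F2 G1 G2.
    intros A B X Y A' B' X' Y' HA HB HX HY -> -> -> ->.
    simpl in HN, HM.
    assert (DA := is_derive_unique _ _ _ HA). assert (DB := is_derive_unique _ _ _ HB).
    assert (DX := is_derive_unique _ _ _ HX). assert (DY := is_derive_unique _ _ _ HY).
    split; simpl;
    (auto_derive;
     [ repeat split; try (eexists; eassumption); assumption
     | change (Derive (fun y => A y) x) with (Derive A x);
       change (Derive (fun y => B y) x) with (Derive B x);
       change (Derive (fun y => X y) x) with (Derive X x);
       change (Derive (fun y => Y y) x) with (Derive Y x);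
       rewrite DA, DB, DX, DY; field;
       split; [contradict HM | contradict HN]; rewrite <- ?HM, <- ?HN; ring ]). }
  apply (E _ _ _ _ _ _ _ _ F1 F2 G1 G2); try (now apply surjective_pairing);
   apply FunctionalExtensionality.functional_extensionality; intros y; apply surjective_pairing.
Qed.

(** * Moving the line of integration *)

(** This rests on the uniform continuity of [u] on a compact rectangle around the segment. *)
Lemma parametric_integral_continuous (u : R -> R -> R) (lo hi S T s : R) :
  S <= T -> lo < s < hi ->
  (forall x t, lo < x < hi -> continuity_2d_pt u x t) ->
  (forall x, lo < x < hi -> ex_RInt (u x) S T) ->
  continuity_pt (fun x => RInt (u x) S T) s.
Proof.
  intros HST Hs Hu Hex.
  apply continuity_pt_filterlim. apply filterlim_locally. intros eps.
  set (lo' := (lo + s) / 2). set (hi' := (s + hi) / 2).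
  assert (He : 0 < eps / ((T - S) + 1)).
  { apply Rdiv_lt_0_compat; [apply cond_pos | lra]. }
  destruct (uniform_continuity_2d u lo' hi' S T) with (eps := mkposreal _ He)
    as [delta Hd].
  { intros x y Hx _. apply Hu. unfold lo', hi' in Hx. lra. }
  assert (Hr : 0 < Rmin delta (Rmin (s - lo') (hi' - s))).
  { apply Rmin_pos; [apply cond_pos | apply Rmin_pos; unfold lo', hi'; lra]. }
  exists (mkposreal _ Hr). intros y Hy.
  change (Rabs (y - s) < Rmin delta (Rmin (s - lo') (hi' - s))) in Hy.
  apply Rmin_Rgt_l in Hy as [Hy1 Hy2]. apply Rmin_Rgt_l in Hy2 as [Hy2 Hy3].
  apply Rabs_def2 in Hy2. apply Rabs_def2 in Hy3.
  assert (Hyin : lo < y < hi) by (unfold lo', hi' in *; lra).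
  change (Rabs (RInt (u y) S T - RInt (u s) S T) < eps).
  change (RInt (u y) S T - RInt (u s) S T) with (minus (RInt (u y) S T) (RInt (u s) S T)).
  rewrite <- RInt_minus by (apply Hex; lra).
  assert (B : Rabs (RInt (fun t => minus (u y t) (u s t)) S T)
              <= (T - S) * (eps / ((T - S) + 1))).
  { apply abs_RInt_le_const; trivial.
    - apply (ex_RInt_minus (V := R_NormedModule)); apply Hex; assumption.
    - intros t Ht. apply Rlt_le. apply Hd; unfold lo', hi' in *; try lra.
      rewrite Rminus_diag, Rabs_R0. apply cond_pos. }
  apply Rle_lt_trans with (1 := B).
  apply Rmult_lt_reg_r with ((T - S) + 1); [lra|].
  field_simplify; [|lra]. assert (0 < eps) by apply cond_pos. nra.
Qed.

Lemma continuity_2d_snd (u : R -> R -> R) (s t : R) :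
  continuity_2d_pt u s t -> continuous (u s) t.
Proof.
  intros H. apply filterlim_locally. intros eps. destruct (H eps) as [d Hd].
  exists d. intros y Hy. apply Hd. rewrite Rminus_diag, Rabs_R0. apply cond_pos. exact Hy.
Qed.

Lemma ex_RInt_snd (u : R -> R -> R) (s S T : R) :
  (forall t, continuity_2d_pt u s t) -> ex_RInt (u s) S T.
Proof.
  intros H. apply (ex_RInt_continuous (V := R_CompleteNormedModule)). intros t _.
  now apply continuity_2d_snd.
Qed.

(** Cauchy's theorem on the rectangle with vertical sides [Re w = al] and [Re w = be].
    For [f = u + iv] the equation [du/dx = dv/dy = D] makes the derivative of the
    integral of [u] along a vertical segment equal to the variation of [v] along it.
    Taking [(u, v)] to be the parts of [f], then of [-i f], covers both parts of the
    integral.  On the line [Re w = m] only continuity of [u] is known. *)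
Lemma vertical_integral_shift (u v D : R -> R -> R) (lo m hi : R) (S T : R) (al be M : R) :
  S <= T -> lo < al < m -> m < be < hi ->
  (forall s t, lo < s < hi -> continuity_2d_pt u s t) ->
  (forall s t, lo < s < hi -> s <> m ->
     is_derive (fun x => u x t) s (D s t) /\ is_derive (fun y => v s y) t (D s t) /\
     continuity_2d_pt D s t) ->
  (forall s, lo < s < hi -> Rabs (v s T - v s S) <= M) ->
  Rabs (RInt (u be) S T - RInt (u al) S T) <= M * (be - al).
Proof.
  intros HST Hal Hbe Hu HD HM.
  assert (Hex : forall x, lo < x < hi -> ex_RInt (u x) S T).
  { intros x Hx. apply ex_RInt_snd. intros t. now apply Hu. }
  assert (Hder : forall s, lo < s < hi -> s <> m ->
            is_derive (fun x => RInt (u x) S T) s (v s T - v s S)).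
  { intros s Hs Hsm.
    assert (Hloc : locally s (fun x => lo < x < hi /\ x <> m)).
    { apply filter_and. apply (open_and _ _ (open_gt lo) (open_lt hi)); lra.
      apply (open_neq m); trivial. }
    replace (v s T - v s S) with (RInt (fun t => Derive (fun x => u x t) s) S T).
    - apply is_derive_RInt_param.
      + revert Hloc. apply filter_imp. intros x [Hx Hxm] t _. eexists. exact (proj1 (HD x t Hx Hxm)).
      + intros t _. apply continuity_2d_pt_ext_loc with D; [|exact (proj2 (proj2 (HD s t Hs Hsm)))].
        destruct Hloc as [d Hd]. exists d. intros x y Hx _. symmetry.
        apply is_derive_unique. destruct (Hd x Hx) as [H1 H2]. exact (proj1 (HD x y H1 H2)).
      + revert Hloc. apply filter_imp. intros x [Hx _]. now apply Hex.
    - rewrite (RInt_ext _ (D s)).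
      2: { intros t _. apply is_derive_unique. exact (proj1 (HD s t Hs Hsm)). }
      apply is_RInt_unique. apply (is_RInt_derive (v s)).
      + intros t _. exact (proj1 (proj2 (HD s t Hs Hsm))).
      + intros t _. apply continuity_2d_snd. exact (proj2 (proj2 (HD s t Hs Hsm))). }
  assert (Hcont : forall s, lo < s < hi -> continuity_pt (fun x => RInt (u x) S T) s).
  { intros s Hs. now apply parametric_integral_continuous with lo hi. }
  assert (Hhalf : forall x y, lo < x -> x < y -> y < hi -> (y <= m \/ m <= x) ->
     Rabs (RInt (u y) S T - RInt (u x) S T) <= M * (y - x)).
  { intros x y Hx Hxy Hy Hm.
    destruct (MVT_gen (fun x => RInt (u x) S T) x y (fun s => v s T - v s S)) as [z [Hz Ez]].
    - rewrite Rmin_left, Rmax_right by lra. intros z Hz. apply Hder; lra.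
    - rewrite Rmin_left, Rmax_right by lra. intros z Hz. apply Hcont; lra.
    - rewrite Rmin_left, Rmax_right in Hz by lra.
      rewrite Ez, Rabs_mult, (Rabs_right (y - x)) by lra.
      apply Rmult_le_compat_r; [lra|]. apply HM. lra. }
  replace (RInt (u be) S T - RInt (u al) S T) with
    ((RInt (u be) S T - RInt (u m) S T) + (RInt (u m) S T - RInt (u al) S T)) by ring.
  assert (H1 := Hhalf al m ltac:(lra) ltac:(lra) ltac:(lra) ltac:(lra)).
  assert (H2 := Hhalf m be ltac:(lra) ltac:(lra) ltac:(lra) ltac:(lra)).
  apply Rle_trans with (1 := Rabs_triang _ _). lra.
Qed.

(** * Continuity of complex functions of two real variables *)

Definition continuous_2d_C (f : R -> R -> C) (s t : R) : Prop :=
  continuity_2d_pt (fun x y => Re (f x y)) s t /\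
  continuity_2d_pt (fun x y => Im (f x y)) s t.

Lemma continuous_2d_C_ext_loc (f g : R -> R -> C) s t :
  locally_2d (fun x y => f x y = g x y) s t -> continuous_2d_C f s t -> continuous_2d_C g s t.
Proof.
  intros [d Hd] [H1 H2]; split.
  - apply continuity_2d_pt_ext_loc with (2 := H1). exists d; intros x y Hx Hy.
    now rewrite (Hd x y Hx Hy).
  - apply continuity_2d_pt_ext_loc with (2 := H2). exists d; intros x y Hx Hy.
    now rewrite (Hd x y Hx Hy).
Qed.

Lemma continuous_2d_C_const (c : C) s t : continuous_2d_C (fun _ _ => c) s t.
Proof. split; apply continuity_2d_pt_const. Qed.

Lemma continuous_2d_C_minus (f g : R -> R -> C) s t :
  continuous_2d_C f s t -> continuous_2d_C g s t ->
  continuous_2d_C (fun x y => f x y - g x y)%C s t.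
Proof. intros [] []; split; apply continuity_2d_pt_minus; assumption. Qed.

Lemma continuous_2d_C_mult (f g : R -> R -> C) s t :
  continuous_2d_C f s t -> continuous_2d_C g s t ->
  continuous_2d_C (fun x y => f x y * g x y)%C s t.
Proof.
  intros [] []; split; [apply continuity_2d_pt_minus | apply continuity_2d_pt_plus];
    apply continuity_2d_pt_mult; assumption.
Qed.

Lemma continuous_2d_C_inv (f : R -> R -> C) s t :
  continuous_2d_C f s t -> f s t <> 0 -> continuous_2d_C (fun x y => / f x y)%C s t.
Proof.
  intros [H1 H2] H0. apply sum_sqr_neq_0 in H0. simpl in H0.
  split; simpl;
    (apply continuity_2d_pt_mult; [|apply continuity_2d_pt_inv; [|assumption]]);
    repeat first [apply continuity_2d_pt_opp | apply continuity_2d_pt_plus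
                 | apply continuity_2d_pt_mult | apply continuity_2d_pt_const];
    assumption.
Qed.

Lemma continuous_2d_C_div (f g : R -> R -> C) s t :
  continuous_2d_C f s t -> continuous_2d_C g s t -> g s t <> 0 ->
  continuous_2d_C (fun x y => f x y / g x y)%C s t.
Proof. intros; apply continuous_2d_C_mult; trivial; now apply continuous_2d_C_inv. Qed.

Ltac continuity_2d :=
  repeat first
    [ apply continuity_2d_pt_const | apply continuity_2d_pt_id1 | apply continuity_2d_pt_id2
    | apply continuity_2d_pt_plus | apply continuity_2d_pt_minus
    | apply continuity_2d_pt_mult | apply continuity_2d_pt_opp
    | apply (continuity_1d_2d_pt_comp exp); [apply derivable_continuous_pt, derivable_pt_exp|]
    | apply (continuity_1d_2d_pt_comp cos); [apply continuity_cos|]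
    | apply (continuity_1d_2d_pt_comp sin); [apply continuity_sin|]
    | apply (continuity_1d_2d_pt_comp cosh); [apply derivable_continuous_pt, derivable_pt_cosh|]
    | apply (continuity_1d_2d_pt_comp sinh); [apply derivable_continuous_pt, derivable_pt_sinh|] ].

Lemma continuous_2d_Cexp (l : C) s t : continuous_2d_C (fun x y => Cexp (l * (x, y)))%C s t.
Proof. split; simpl; continuity_2d. Qed.

Lemma continuous_2d_Csin s t : continuous_2d_C (fun x y => Csin (PI * (x, y)))%C s t.
Proof.
  apply continuous_2d_C_ext_loc with
    (fun x y => (sin (PI * x) * cosh (PI * y), cos (PI * x) * sinh (PI * y))).
  - apply locally_2d_forall. intros; now rewrite Csin_PI_coord.
  - split; simpl; continuity_2d.
Qed.

(** * The quotient (e^(lw) - 1) / sin(PI w) off the imaginary axis *)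

(** The complex derivative of [sin (PI w)] at [w = s + it]. *)
Definition Csin_PI_deriv (s t : R) : C :=
  (PI * (cos (PI * s) * cosh (PI * t)), - (PI * (sin (PI * s) * sinh (PI * t)))).

Lemma is_derive_Cexp_re (l : C) s t :
  is_derive_curve (fun x => Cexp (l * (x, t)) - 1)%C s (l * Cexp (l * (s, t)))%C.
Proof. destruct l as [p q]; split; simpl; auto_derive; trivial; unfold Rminus; ring. Qed.

Lemma is_derive_Cexp_im (l : C) s t :
  is_derive_curve (fun y => Cexp (l * (s, y)) - 1)%C t (Ci * (l * Cexp (l * (s, t))))%C.
Proof. destruct l as [p q]; split; simpl; auto_derive; trivial; unfold Rminus; ring. Qed.

Lemma is_derive_Csin_re s t :
  is_derive_curve (fun x => Csin (PI * (x, t))) s (Csin_PI_deriv s t).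
Proof.
  eapply is_derive_curve_ext_loc.
  { apply filter_forall. intros x. symmetry. apply Csin_PI_coord. }
  split; simpl; auto_derive; trivial; ring.
Qed.

Lemma is_derive_Csin_im s t :
  is_derive_curve (fun y => Csin (PI * (s, y))) t (Ci * Csin_PI_deriv s t)%C.
Proof.
  eapply is_derive_curve_ext_loc.
  { apply filter_forall. intros x. symmetry. apply Csin_PI_coord. }
  split; simpl; unfold cosh, sinh; auto_derive; trivial; field.
Qed.

(** The value at [0] is the limit, which makes the function continuous there
    ([regular_quotient_continuous]). *)
Definition regular_quotient (l w : C) : C :=
  if Ceq_dec w 0 then (l / PI)%C else ((Cexp (l * w) - 1) / Csin (PI * w))%C.

(** The complex derivative of [regular_quotient l] at [w = s + it], off the imaginary axis. *)
Definition regular_quotient_deriv (l : C) (s t : R) : C :=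
  ((l * Cexp (l * (s, t)) * Csin (PI * (s, t)) - (Cexp (l * (s, t)) - 1) * Csin_PI_deriv s t)
   / (Csin (PI * (s, t)) * Csin (PI * (s, t))))%C.

Lemma pair_neq_0 (s t : R) : s <> 0 -> (s, t) <> RtoC 0.
Proof. intros H E. apply H. now injection E. Qed.

Lemma regular_quotient_def (l w : C) :
  w <> 0 -> regular_quotient l w = ((Cexp (l * w) - 1) / Csin (PI * w))%C.
Proof. intros H. unfold regular_quotient. destruct (Ceq_dec w 0); [easy | reflexivity]. Qed.

(** The two partial derivatives differ by the factor [Ci]; these are the Cauchy-Riemann
    equations. *)
Lemma regular_quotient_derivatives (l : C) s t : -1 < s < 1 -> s <> 0 ->
  is_derive_curve (fun x => regular_quotient l (x, t)) s (regular_quotient_deriv l s t) /\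
  is_derive_curve (fun y => regular_quotient l (s, y)) t (Ci * regular_quotient_deriv l s t)%C.
Proof.
  intros Hs H0.
  assert (HS : Csin (PI * (s, t)) <> 0) by (apply Csin_PI_neq_0; [easy | now apply pair_neq_0]).
  split.
  - apply is_derive_curve_ext_loc with (fun x => (Cexp (l * (x, t)) - 1) / Csin (PI * (x, t)))%C.
    + generalize (open_neq 0 s H0). apply filter_imp. intros x Hx.
      symmetry. apply regular_quotient_def. now apply pair_neq_0.
    + apply is_derive_curve_div; trivial. apply is_derive_Cexp_re. apply is_derive_Csin_re.
  - apply is_derive_curve_ext_loc with (fun y => (Cexp (l * (s, y)) - 1) / Csin (PI * (s, y)))%C.
    + apply filter_forall. intros y. symmetry. apply regular_quotient_def. now apply pair_neq_0.
    + replace (Ci * regular_quotient_deriv l s t)%C with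
       ((Ci * (l * Cexp (l * (s, t))) * Csin (PI * (s, t)) -
         (Cexp (l * (s, t)) - 1) * (Ci * Csin_PI_deriv s t)) /
          (Csin (PI * (s, t)) * Csin (PI * (s, t))))%C by (unfold regular_quotient_deriv; field; trivial).
      apply is_derive_curve_div; trivial. apply is_derive_Cexp_im. apply is_derive_Csin_im.
Qed.

Lemma regular_quotient_deriv_continuous (l : C) s t : -1 < s < 1 -> s <> 0 ->
  continuous_2d_C (regular_quotient_deriv l) s t.
Proof.
  intros Hs H0.
  assert (HS : Csin (PI * (s, t)) <> 0) by (apply Csin_PI_neq_0; [easy | now apply pair_neq_0]).
  assert (HE := continuous_2d_Cexp l s t). assert (HC := continuous_2d_Csin s t).
  apply continuous_2d_C_div.
  - apply continuous_2d_C_minus; apply continuous_2d_C_mult; trivial.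
    + apply continuous_2d_C_mult; trivial. apply continuous_2d_C_const.
    + apply continuous_2d_C_minus; trivial. apply continuous_2d_C_const.
    + split; simpl; continuity_2d.
  - now apply continuous_2d_C_mult.
  - now apply Cmult_neq_0.
Qed.

(** * Second-order estimates for the exponential and the sine *)

Lemma Cmod_le_sum (z : C) : Cmod z <= Rabs (Re z) + Rabs (Im z).
Proof.
  destruct z as [x y]; simpl.
  replace (x, y) with (x + y * Ci)%C by (apply C_ext; simpl; ring).
  apply Rle_trans with (1 := Cmod_triangle _ _).
  rewrite Cmod_mult, !Cmod_R, Cmod_Ci, Rmult_1_r. apply Rle_refl.
Qed.

Lemma Rabs_Im_le_Cmod (z : C) : Rabs (Im z) <= Cmod z.
Proof. apply Rle_trans with (2 := Rmax_Cmod z). apply Rmax_r. Qed.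

Lemma exp_quadratic (x : R) : Rabs x <= / 2 -> Rabs (exp x - 1 - x) <= 2 * (x * x).
Proof.
  intros Hx. apply Rabs_le_between in Hx.
  assert (H1 := exp_ineq1_le x). assert (H2 := exp_ineq1_le (- x)).
  assert (HE : exp x * exp (- x) = 1) by (rewrite <- exp_plus, Rplus_opp_r; apply exp_0).
  assert (H3 := exp_pos x).
  apply Rabs_le. split; [nra|].
  assert (exp x * (1 - x) <= 1) by nra.
  assert (x * x * (1 - 2 * x) >= 0) by nra.
  assert ((1 + x + 2 * (x * x)) * (1 - x) >= 1) by nra.
  nra.
Qed.

Lemma Rabs_sin_le (y : R) : Rabs (sin y) <= Rabs y.
Proof.
  destruct (MVT_abs sin cos 0 y) as [z [E _]].
  { intros; apply derivable_pt_lim_sin. }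
  rewrite sin_0, !Rminus_0_r in E. rewrite E.
  assert (Rabs (cos z) <= 1) by (apply Rabs_le, COS_bound).
  assert (H0 := Rabs_pos y). nra.
Qed.

Lemma cos_quadratic (y : R) : Rabs (cos y - 1) <= y * y.
Proof.
  replace y with (2 * (y / 2)) at 1 by field. rewrite cos_2a_sin.
  assert (H := Rabs_sin_le (y / 2)). apply Rsqr_le_abs_1 in H. unfold Rsqr in H.
  apply Rabs_le. nra.
Qed.

Lemma sin_quadratic (y : R) : Rabs y <= / 2 -> Rabs (sin y - y) <= y * y / 2.
Proof.
  intros Hy.
  destruct (MVT_abs (fun y => sin y - y) (fun y => cos y - 1) 0 y) as [z [E Hz]].
  { intros c _. apply is_derive_Reals. auto_derive; trivial; ring. }
  rewrite sin_0, !Rminus_0_r in E. rewrite E.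
  assert (Hzy : z * z <= y * y).
  { unfold Rmin, Rmax in Hz. destruct (Rle_dec 0 y); nra. }
  assert (B := cos_quadratic z). assert (P := Rabs_pos y). assert (Q := Rabs_pos (cos z - 1)).
  apply Rle_trans with (y * y * / 2); [|lra]. apply Rmult_le_compat; lra.
Qed.

Lemma Cexp_quadratic (z : C) :
  Cmod z <= / 2 -> Cmod (Cexp z - 1 - z) <= 4 * (Cmod z * Cmod z).
Proof.
  intros Hz.
  assert (Hx := Rle_trans _ _ _ (re_le_Cmod z) Hz).
  assert (Hy := Rle_trans _ _ _ (Rabs_Im_le_Cmod z) Hz).
  replace (Cmod z * Cmod z) with (Re z * Re z + Im z * Im z).
  2: { destruct z as [x y]; unfold Cmod; simpl. rewrite sqrt_sqrt; nra. }
  destruct z as [x y]; simpl in *.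
  apply Rle_trans with (1 := Cmod_le_sum _). simpl.
  assert (E := exp_quadratic x Hx). assert (Cq := cos_quadratic y).
  assert (Sq := sin_quadratic y Hy). assert (Sl := Rabs_sin_le y).
  assert (Ex : Rabs (exp x - 1) <= 2 * Rabs x).
  { replace (exp x - 1) with ((exp x - 1 - x) + x) by ring.
    apply Rle_trans with (1 := Rabs_triang _ _).
    replace (x * x) with (Rabs x * Rabs x) in E by (rewrite <- Rabs_mult; apply Rabs_right; nra).
    assert (P := Rabs_pos x). nra. }
  assert (HRe : Rabs (exp x * cos y + - (1) + - x) <= 2 * (x * x) + 3 / 2 * (y * y)).
  { replace (exp x * cos y + - (1) + - x) with
      ((exp x - 1 - x) * cos y + (1 + x) * (cos y - 1)) by ring.
    apply Rle_trans with (1 := Rabs_triang _ _). rewrite !Rabs_mult.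
    assert (Rabs (cos y) <= 1) by (apply Rabs_le, COS_bound).
    assert (Rabs (1 + x) <= 3 / 2).
    { apply Rle_trans with (1 := Rabs_triang _ _). rewrite Rabs_R1. lra. }
    apply Rplus_le_compat.
    - rewrite <- (Rmult_1_r (2 * (x * x))). apply Rmult_le_compat; trivial; apply Rabs_pos.
    - apply Rmult_le_compat; trivial; apply Rabs_pos. }
  assert (HIm : Rabs (exp x * sin y + - 0 + - y) <= x * x + y * y + y * y / 2).
  { replace (exp x * sin y + - 0 + - y) with ((exp x - 1) * sin y + (sin y - y)) by ring.
    apply Rle_trans with (1 := Rabs_triang _ _). rewrite Rabs_mult.
    apply Rplus_le_compat; trivial.
    apply Rle_trans with (2 * Rabs x * Rabs y).
    - apply Rmult_le_compat; trivial; apply Rabs_pos.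
    - replace (x * x) with (Rabs x * Rabs x) by (rewrite <- Rabs_mult; apply Rabs_right; nra).
      replace (y * y) with (Rabs y * Rabs y) by (rewrite <- Rabs_mult; apply Rabs_right; nra).
      assert (P := Rle_0_sqr (Rabs x - Rabs y)). unfold Rsqr in P. lra. }
  assert (Px := Rle_0_sqr x). assert (Py := Rle_0_sqr y). unfold Rsqr in Px, Py. lra.
Qed.

Lemma Csin_quadratic (w : C) :
  PI * Cmod w <= / 2 -> Cmod (Csin (PI * w) - PI * w) <= 4 * (PI * PI) * (Cmod w * Cmod w).
Proof.
  intros Hw. assert (HP := PI_RGT_0).
  assert (M : Cmod (Ci * (PI * w)) = PI * Cmod w).
  { rewrite !Cmod_mult, Cmod_Ci, Cmod_R, Rabs_right; lra. }
  assert (E1 := Cexp_quadratic (Ci * (PI * w))). assert (E2 := Cexp_quadratic (- (Ci * (PI * w)))).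
  rewrite Cmod_opp in E2. rewrite M in E1, E2. specialize (E1 Hw). specialize (E2 Hw).
  set (e := Cexp (Ci * (PI * w))) in *. set (f := Cexp (- (Ci * (PI * w)))) in *.
  replace (Csin (PI * w) - PI * w)%C with
    (((e - 1 - Ci * (PI * w)) - (f - 1 - - (Ci * (PI * w)))) / (2 * Ci))%C.
  2: { unfold Csin. fold e f. field. intros H; injection H; lra. }
  unfold Cdiv, Cminus at 1. rewrite Cmod_mult.
  replace (Cmod (/ (2 * Ci))) with (/ 2).
  2: { rewrite Cmod_inv, Cmod_mult, Cmod_Ci, Cmod_R, Rabs_right; [field | lra |].
       intros H; injection H; lra. }
  assert (T := Cmod_triangle (e - 1 - Ci * (PI * w)) (- (f - 1 - - (Ci * (PI * w))))).
  rewrite Cmod_opp in T. nra.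
Qed.

(** * Removable singularity and decay of the quotient *)

(** Numerator and denominator agree with their linear parts [l w] and [PI w] up to
    [O(|w|^2)], while the denominator is at least [PI |w| / 2]. *)
Lemma regular_quotient_near_0 (l : C) : exists B d, 0 < B /\ 0 < d /\
  forall w, Cmod w < d -> Cmod (regular_quotient l w - regular_quotient l 0) <= B * Cmod w.
Proof.
  assert (HP := PI_RGT_0). assert (HP2 : 2 < PI) by (generalize PI2_1; lra).
  assert (Hl := Cmod_ge_0 l).
  set (B := 4 * PI * (Cmod l * Cmod l) + Cmod l * (4 * (PI * PI)) + 1).
  assert (HPi : RtoC PI <> 0) by (intros H; apply RtoC_inj in H; lra).
  (* Below this radius [l w] and [PI w] satisfy the hypotheses of the quadratic estimates
     and [|sin (PI w)| >= PI |w| / 2]. *)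
  exists B, (/ (8 * PI * (Cmod l + 1))).
  assert (HB : 0 < B) by (unfold B; nra).
  repeat split; trivial. { apply Rinv_0_lt_compat. nra. }
  intros w Hw.
  destruct (Ceq_dec w 0) as [-> | H0].
  { replace (regular_quotient l 0 - regular_quotient l 0)%C with (RtoC 0) by ring. rewrite Cmod_0. lra. }
  assert (Hw0 : 0 < Cmod w) by now apply Cmod_gt_0.
  assert (K : 8 * PI * (Cmod l + 1) * Cmod w < 1).
  { apply Rmult_lt_compat_l with (r := 8 * PI * (Cmod l + 1)) in Hw; [|nra].
    rewrite Rinv_r in Hw; nra. }
  assert (K1 : 8 * PI * Cmod w <= 1) by nra.
  assert (K2 : Cmod l * Cmod w <= / 2) by nra.
  assert (E := Cexp_quadratic (l * w)). rewrite Cmod_mult in E. specialize (E K2).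
  assert (S := Csin_quadratic w ltac:(lra)).
  assert (SL : PI * Cmod w / 2 <= Cmod (Csin (PI * w))).
  { assert (T := Cmod_triangle (Csin (PI * w)) (- (Csin (PI * w) - PI * w))).
    replace (Csin (PI * w) + - (Csin (PI * w) - PI * w))%C with (PI * w)%C in T by ring.
    rewrite Cmod_opp, Cmod_mult, Cmod_R, Rabs_right in T by lra.
    assert (0 <= PI * Cmod w * (1 - 8 * PI * Cmod w)) by (apply Rmult_le_pos; nra). lra. }
  assert (SN : Csin (PI * w) <> 0). { apply Cmod_gt_0. nra. }
  rewrite regular_quotient_def by trivial.
  replace (regular_quotient l 0) with (l / PI)%C by (unfold regular_quotient; destruct (Ceq_dec 0 0); easy).
  replace ((Cexp (l * w) - 1) / Csin (PI * w) - l / PI)%C with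
    ((PI * (Cexp (l * w) - 1 - l * w) - l * (Csin (PI * w) - PI * w)) / (PI * Csin (PI * w)))%C
    by (field; split; trivial).
  unfold Cdiv. rewrite Cmod_mult, Cmod_inv, Cmod_mult, Cmod_R, Rabs_right by
     (try apply Cmult_neq_0; trivial; lra).
  assert (N : Cmod (PI * (Cexp (l * w) - 1 - l * w) - l * (Csin (PI * w) - PI * w))
     <= B * (Cmod w * Cmod w)).
  { apply Rle_trans with (1 := Cmod_triangle _ _). rewrite Cmod_opp, !Cmod_mult, Cmod_R, Rabs_right by lra.
    unfold B. nra. }
  assert (D0 : Cmod w <= Cmod (Csin (PI * w))) by nra.
  assert (D : Cmod w <= PI * Cmod (Csin (PI * w))) by nra.
  assert (Q : 0 < PI * Cmod (Csin (PI * w))) by lra.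
  apply Rmult_le_reg_r with (PI * Cmod (Csin (PI * w))); trivial.
  rewrite Rmult_assoc, Rinv_l, Rmult_1_r by lra.
  apply Rle_trans with (1 := N). rewrite Rmult_assoc.
  apply Rmult_le_compat_l; [lra|]. apply Rmult_le_compat_l; lra.
Qed.

Lemma regular_quotient_continuous (l : C) s t : -1 < s < 1 ->
  continuous_2d_C (fun x y => regular_quotient l (x, y)) s t.
Proof.
  intros Hs.
  destruct (Ceq_dec (s, t) 0) as [E | E].
  - injection E as -> ->.
    destruct (regular_quotient_near_0 l) as (B & d & HB & Hd & K).
    assert (W : forall eps : posreal, exists r : posreal, forall x y,
       Rabs (x - 0) < r -> Rabs (y - 0) < r -> Cmod (regular_quotient l (x, y) - regular_quotient l 0) < eps).
    { intros eps. assert (He := cond_pos eps).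
      assert (Hr : 0 < Rmin (d / 2) (eps / (2 * B))).
      { apply Rmin_pos; [lra|]. apply Rdiv_lt_0_compat; lra. }
      exists (mkposreal _ Hr). simpl. intros x y Hx Hy. rewrite Rminus_0_r in Hx, Hy.
      apply Rmin_Rgt_l in Hx as [Hx1 Hx2]. apply Rmin_Rgt_l in Hy as [Hy1 Hy2].
      assert (Hm := Cmod_le_sum (x, y)). simpl in Hm.
      apply Rle_lt_trans with (B * Cmod (x, y)); [apply K; lra|].
      apply Rle_lt_trans with (B * (Rabs x + Rabs y)); [apply Rmult_le_compat_l; lra|].
      apply Rlt_le_trans with (B * (eps / (2 * B) + eps / (2 * B))).
      apply Rmult_lt_compat_l; lra. right; field; lra. }
    split; intros eps; destruct (W eps) as [r Hr]; exists r; intros x y Hx Hy;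
      apply Rle_lt_trans with (2 := Hr x y Hx Hy).
    + exact (re_le_Cmod (regular_quotient l (x, y) - regular_quotient l 0)).
    + exact (Rabs_Im_le_Cmod (regular_quotient l (x, y) - regular_quotient l 0)).
  - assert (HS : Csin (PI * (s, t)) <> 0) by now apply Csin_PI_neq_0.
    apply continuous_2d_C_ext_loc with (fun x y => (Cexp (l * (x, y)) - 1) / Csin (PI * (x, y)))%C.
    + destruct (Req_dec s 0) as [-> | Hs0].
      * assert (Ht : t <> 0) by (intros ->; now apply E).
        destruct (open_neq 0 t Ht) as [d Hd]. exists d. intros x y _ Hy. symmetry.
        apply regular_quotient_def. intros H. injection H as _ H. now apply (Hd y Hy).
      * destruct (open_neq 0 s Hs0) as [d Hd]. exists d. intros x y Hx _. symmetry.
        apply regular_quotient_def. apply pair_neq_0. exact (Hd x Hx).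
    + apply continuous_2d_C_div; trivial; [|apply continuous_2d_Csin].
      apply continuous_2d_C_minus; [apply continuous_2d_Cexp | apply continuous_2d_C_const].
Qed.

Lemma exp_le_compat (x y : R) : x <= y -> exp x <= exp y.
Proof. intros [H | ->]; [now apply Rlt_le, exp_increasing | apply Rle_refl]. Qed.

Definition quotient_bound (l : C) (t : R) : R :=
  8 * exp (Rabs (Re l)) * exp (- ((PI - Rabs (Im l)) * Rabs t)).

Lemma sinh_lower (x : R) : 1 <= x -> exp x / 4 <= sinh x.
Proof.
  intros Hx. unfold sinh.
  assert (H1 := exp_ineq1_le x).
  assert (HE : exp x * exp (- x) = 1) by (rewrite <- exp_plus, Rplus_opp_r; apply exp_0).
  assert (H3 := exp_pos (- x)). nra.
Qed.

Lemma Csin_lower (s t : R) : 1 <= Rabs t -> exp (PI * Rabs t) / 4 <= Cmod (Csin (PI * (s, t))).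
Proof.
  intros Ht. assert (HP2 : 2 < PI) by (generalize PI2_1; lra).
  assert (A : sinh (PI * Rabs t) ^ 2 = sinh (PI * t) ^ 2).
  { unfold Rabs; destruct (Rcase_abs t); trivial. unfold sinh.
    replace (PI * - t) with (- (PI * t)) by ring. rewrite Ropp_involutive. field. }
  assert (B := sinh_lower (PI * Rabs t) ltac:(nra)).
  apply Rle_trans with (1 := B).
  assert (0 <= sinh (PI * Rabs t)). { assert (P := exp_pos (PI * Rabs t)). lra. }
  unfold Cmod. rewrite <- (sqrt_pow2 (sinh (PI * Rabs t))) by trivial.
  apply sqrt_le_1_alt. rewrite A.
  change (fst ?z) with (Re z). change (snd ?z) with (Im z). rewrite Csin_norm.
  assert (0 <= sin (PI * s) ^ 2) by apply pow2_ge_0. lra.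
Qed.

(** The numerator grows at most like [exp (|Im l| |t|)], the denominator at least like
    [exp (PI |t|)]. *)
Lemma regular_quotient_decay (l : C) (s t : R) :
  -1 < s < 1 -> 1 <= Rabs t -> Cmod (regular_quotient l (s, t)) <= quotient_bound l t.
Proof.
  intros Hs Ht. assert (HP := PI_RGT_0).
  assert (H0 : (s, t) <> RtoC 0).
  { intros E. injection E as _ ->. rewrite Rabs_R0 in Ht. lra. }
  rewrite regular_quotient_def by trivial. unfold Cdiv.
  rewrite Cmod_mult, Cmod_inv by now apply Csin_PI_neq_0.
  assert (L := Csin_lower s t Ht).
  assert (E0 := exp_pos (PI * Rabs t)).
  assert (N : Cmod (Cexp (l * (s, t)) - 1) <= 2 * exp (Rabs (Re l) + Rabs (Im l) * Rabs t)).
  { apply Rle_trans with (1 := Cmod_triangle _ _).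
    rewrite Cmod_opp, Cmod_R, Rabs_R1, Cmod_Cexp.
    assert (Re (l * (s, t))%C <= Rabs (Re l) + Rabs (Im l) * Rabs t).
    { destruct l as [p q]; simpl.
      apply Rle_trans with (1 := Rle_abs _).
      apply Rle_trans with (1 := Rabs_triang _ _). rewrite Rabs_Ropp, !Rabs_mult.
      assert (Rabs s <= 1) by (apply Rabs_le; lra). assert (P := Rabs_pos p). nra. }
    assert (exp (Re (l * (s, t))) <= exp (Rabs (Re l) + Rabs (Im l) * Rabs t)) by now apply exp_le_compat.
    assert (1 <= exp (Rabs (Re l) + Rabs (Im l) * Rabs t)).
    { rewrite <- exp_0. apply exp_le_compat.
      assert (P := Rabs_pos (Re l)). assert (Q := Rabs_pos (Im l)). nra. }
    lra. }
  apply Rmult_le_reg_r with (Cmod (Csin (PI * (s, t)))); [lra|].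
  rewrite Rmult_assoc, Rinv_l, Rmult_1_r by lra.
  apply Rle_trans with (1 := N).
  apply Rle_trans with (quotient_bound l t * (exp (PI * Rabs t) / 4)).
  - unfold quotient_bound.
    replace (Rabs (Re l) + Rabs (Im l) * Rabs t) with
      (Rabs (Re l) + (- ((PI - Rabs (Im l)) * Rabs t) + PI * Rabs t)) by ring.
    rewrite !exp_plus. right. field.
  - apply Rmult_le_compat_l; trivial. unfold quotient_bound.
    apply Rmult_le_pos; [|apply Rlt_le, exp_pos]. assert (P := exp_pos (Rabs (Re l))). lra.
Qed.

(** * Integrals over a vertical line *)

(** Componentwise convergence, the ends [-oo] and [+oo] being independent; in this
    form multiplication by a complex constant is a real linear combination of integrals. *)
Definition is_line_integral (f : R -> C) (l : C) : Prop :=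
  is_RInt_gen (fun t => Re (f t)) (Rbar_locally m_infty) (Rbar_locally p_infty) (Re l) /\
  is_RInt_gen (fun t => Im (f t)) (Rbar_locally m_infty) (Rbar_locally p_infty) (Im l).

Lemma is_RInt_gen_ext_all (f g : R -> R) (Fa Fb : (R -> Prop) -> Prop) (l : R) :
  Filter Fa -> Filter Fb -> (forall t, f t = g t) ->
  is_RInt_gen f Fa Fb l -> is_RInt_gen g Fa Fb l.
Proof.
  intros HFa HFb E. apply is_RInt_gen_ext. apply filter_forall. intros ab x _. apply E.
Qed.

Lemma is_line_integral_ext (f g : R -> C) (l : C) :
  (forall t, f t = g t) -> is_line_integral f l -> is_line_integral g l.
Proof.
  intros E [H1 H2]; split.
  - refine (is_RInt_gen_ext_all _ _ _ _ _ _ _ _ H1). intros t. now rewrite E.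
  - refine (is_RInt_gen_ext_all _ _ _ _ _ _ _ _ H2). intros t. now rewrite E.
Qed.

Lemma is_line_integral_plus (f g : R -> C) (k l : C) :
  is_line_integral f k -> is_line_integral g l ->
  is_line_integral (fun t => f t + g t)%C (k + l)%C.
Proof.
  intros [F1 F2] [G1 G2]; split.
  - exact (is_RInt_gen_plus _ _ _ _ F1 G1).
  - exact (is_RInt_gen_plus _ _ _ _ F2 G2).
Qed.

Lemma is_line_integral_scal (z : C) (f : R -> C) (l : C) :
  is_line_integral f l -> is_line_integral (fun t => z * f t)%C (z * l)%C.
Proof.
  intros [F1 F2]; split.
  - exact (is_RInt_gen_minus _ _ _ _ (is_RInt_gen_scal _ (Re z) _ F1)
             (is_RInt_gen_scal _ (Im z) _ F2)).
  - exact (is_RInt_gen_plus _ _ _ _ (is_RInt_gen_scal _ (Re z) _ F2)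
             (is_RInt_gen_scal _ (Im z) _ F1)).
Qed.

Lemma is_line_integral_RInt_gen (f : R -> C) (l : C) :
  is_line_integral f l ->
  is_RInt_gen (V := C_R_NormedModule) f (Rbar_locally m_infty) (Rbar_locally p_infty) l.
Proof.
  intros [H1 H2] P [eps HP].
  assert (L1 := H1 (fun y => ball (Re l) eps y) (locally_ball _ _)).
  assert (L2 := H2 (fun y => ball (Im l) eps y) (locally_ball _ _)).
  unfold filtermapi in *. generalize (filter_and _ _ L1 L2). apply filter_imp.
  intros [a b] [(x & Ix & Bx) (y & Iy & By)]. exists (x, y). split.
  - exact (is_RInt_fct_extend_pair (U := R_NormedModule) (V := R_NormedModule) f a b x y Ix Iy).
  - apply HP. split; assumption.
Qed.

(** The truncations [a <= -1] and [1 <= b] are where the bound on the boundary terms is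
    available. *)
Lemma is_RInt_gen_vanishing (f m : R -> R) :
  (forall a b, ex_RInt f a b) ->
  (forall a b, a <= -1 -> 1 <= b -> Rabs (RInt f a b) <= m a + m b) ->
  filterlim m (Rbar_locally m_infty) (locally 0) ->
  filterlim m (Rbar_locally p_infty) (locally 0) ->
  is_RInt_gen f (Rbar_locally m_infty) (Rbar_locally p_infty) 0.
Proof.
  intros Hex Hb Hm Hp P [eps HP]. unfold filtermapi.
  assert (He : 0 < eps / 2) by (generalize (cond_pos eps); lra).
  assert (Lm := Hm _ (locally_ball 0 (mkposreal _ He))).
  assert (Lp := Hp _ (locally_ball 0 (mkposreal _ He))).
  refine (Filter_prod _ _ _ (fun a => a < -1 /\ ball 0 (mkposreal _ He) (m a))
           (fun b => 1 < b /\ ball 0 (mkposreal _ He) (m b)) _ _ _).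
  - apply filter_and; [exists (-1); trivial | exact Lm].
  - apply filter_and; [exists 1; trivial | exact Lp].
  - intros a b [Ha Ba] [Hb' Bb]. exists (RInt f a b). split.
    + apply (RInt_correct (V := R_CompleteNormedModule)), Hex.
    + apply HP. change (Rabs (RInt f a b - 0) < eps).
      change (Rabs (m a - 0) < eps / 2) in Ba. change (Rabs (m b - 0) < eps / 2) in Bb.
      rewrite Rminus_0_r in *. apply Rabs_def2 in Ba. apply Rabs_def2 in Bb.
      apply Rle_lt_trans with (1 := Hb a b ltac:(lra) ltac:(lra)). lra.
Qed.

Lemma quotient_bound_even (l : C) (t : R) : quotient_bound l (- t) = quotient_bound l t.
Proof. unfold quotient_bound. now rewrite Rabs_Ropp. Qed.

Lemma quotient_bound_lim (l : C) : Rabs (Im l) < PI ->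
  filterlim (quotient_bound l) (Rbar_locally p_infty) (locally 0).
Proof.
  intros Hl.
  assert (H : is_lim (fun t => 8 * exp (Rabs (Re l)) * exp (- ((PI - Rabs (Im l)) * t))) p_infty
     (8 * exp (Rabs (Re l)) * 0)).
  { apply (is_lim_scal_l _ _ _ 0).
    apply (is_lim_comp exp (fun t => - ((PI - Rabs (Im l)) * t)) p_infty 0 m_infty).
    - apply is_lim_exp_m.
    - apply (is_lim_opp _ _ p_infty).
      evar_last. apply is_lim_scal_l, is_lim_id. simpl.
      destruct (Rle_dec 0 (PI - Rabs (Im l))); [|lra].
      destruct (Rle_lt_or_eq_dec 0 (PI - Rabs (Im l)) r); [reflexivity | lra].
    - exists 0. intros; discriminate. }
  rewrite Rmult_0_r in H.
  apply (is_lim_ext_loc _ (quotient_bound l)) in H; [exact H|].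
  exists 0. intros t Ht. unfold quotient_bound. now rewrite (Rabs_right t) by lra.
Qed.

Lemma filterlim_m_infty (f : R -> R) (F : (R -> Prop) -> Prop) :
  filterlim (fun t => f (- t)) (Rbar_locally p_infty) F -> filterlim f (Rbar_locally m_infty) F.
Proof.
  intros H P HP. destruct (H P HP) as [M HM]. exists (- M). intros x Hx.
  rewrite <- (Ropp_involutive x). apply (HM (- x)). lra.
Qed.

Lemma Re_Ci_mult (z : C) : Re (Ci * z) = - Im z.
Proof. simpl; unfold Im; ring. Qed.

Lemma Im_Ci_mult (z : C) : Im (Ci * z) = Re z.
Proof. simpl; unfold Re; ring. Qed.

(** On a truncated line the difference of the two integrals is bounded by the size of the
    function at the two ends, which tends to [0]. *)
Lemma regular_quotient_shift_integral (l : C) (c : R) :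
  0 < c < 1 -> Rabs (Im l) < PI ->
  is_line_integral (fun t => regular_quotient l (c, t) - regular_quotient l ((c - 1)%R, t))%C 0.
Proof.
  intros Hc Hl.
  assert (W : forall u v D : R -> R -> R,
    (forall s t, -1 < s < 1 -> continuity_2d_pt u s t) ->
    (forall s t, -1 < s < 1 -> s <> 0 ->
     is_derive (fun x => u x t) s (D s t) /\ is_derive (fun y => v s y) t (D s t) /\
     continuity_2d_pt D s t) ->
    (forall s t, -1 < s < 1 -> 1 <= Rabs t -> Rabs (v s t) <= quotient_bound l t) ->
    is_RInt_gen (fun t => u c t - u (c - 1) t) (Rbar_locally m_infty) (Rbar_locally p_infty) 0).
  { intros u v D Hu HD Hv.
    assert (Hex : forall s a b, -1 < s < 1 -> ex_RInt (u s) a b).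
    { intros s a b Hs. apply ex_RInt_snd. intros t. now apply Hu. }
    apply is_RInt_gen_vanishing with (quotient_bound l).
    - intros a b. apply (ex_RInt_minus (V := R_NormedModule)); apply Hex; lra.
    - intros a b Ha Hb.
      replace (RInt (fun t => u c t - u (c - 1) t) a b) with
        (RInt (u c) a b - RInt (u (c - 1)) a b).
      2: { symmetry. apply (RInt_minus (V := R_CompleteNormedModule)); apply Hex; lra. }
      replace (quotient_bound l a + quotient_bound l b) with
        ((quotient_bound l a + quotient_bound l b) * (c - (c - 1))) by ring.
      apply vertical_integral_shift with v D (-1) 0 1; trivial; try lra.
      intros s Hs. unfold Rminus. apply Rle_trans with (1 := Rabs_triang _ _).
      rewrite Rabs_Ropp. rewrite Rplus_comm. apply Rplus_le_compat; apply Hv; trivial.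
      + rewrite Rabs_left; lra.
      + rewrite Rabs_right; lra.
    - apply filterlim_m_infty. apply filterlim_ext with (quotient_bound l).
      + intros t. symmetry. apply quotient_bound_even.
      + now apply quotient_bound_lim.
    - now apply quotient_bound_lim. }
  split.
  - apply (W (fun s t => Re (regular_quotient l (s, t))) (fun s t => Im (regular_quotient l (s, t)))
             (fun s t => Re (regular_quotient_deriv l s t))).
    + intros s t Hs. apply (regular_quotient_continuous l s t Hs).
    + intros s t Hs H0. destruct (regular_quotient_derivatives l s t Hs H0) as [[D1 D2] [D3 D4]].
      split; [exact D1 | split].
      * replace (Re (regular_quotient_deriv l s t)) with
          (Im (Ci * regular_quotient_deriv l s t)) by apply Im_Ci_mult.
        exact D4.
      * apply (regular_quotient_deriv_continuous l s t Hs H0).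
    + intros s t Hs Ht. apply Rle_trans with (1 := Rabs_Im_le_Cmod _). now apply regular_quotient_decay.
  - apply (W (fun s t => Im (regular_quotient l (s, t))) (fun s t => - Re (regular_quotient l (s, t)))
             (fun s t => Im (regular_quotient_deriv l s t))).
    + intros s t Hs. apply (regular_quotient_continuous l s t Hs).
    + intros s t Hs H0. destruct (regular_quotient_derivatives l s t Hs H0) as [[D1 D2] [D3 D4]].
      split; [exact D2 | split].
      * replace (Im (regular_quotient_deriv l s t)) with
          (- Re (Ci * regular_quotient_deriv l s t)) by (rewrite Re_Ci_mult; ring).
        exact (is_derive_opp _ _ _ D3).
      * apply (regular_quotient_deriv_continuous l s t Hs H0).
    + intros s t Hs Ht. rewrite Rabs_Ropp.
      apply Rle_trans with (1 := re_le_Cmod _). now apply regular_quotient_decay.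
Qed.

(** * The integral of 1 / sin(PI w) *)

Lemma is_RInt_gen_antiderivative (F f : R -> R) (Fa Fb : (R -> Prop) -> Prop) (la lb : R) :
  Filter Fa -> Filter Fb ->
  (forall t, is_derive F t (f t)) -> (forall t, continuous f t) ->
  filterlim F Fa (locally la) -> filterlim F Fb (locally lb) ->
  is_RInt_gen f Fa Fb (lb - la).
Proof.
  intros HFa HFb HF Hf Ha Hb.
  assert (E : forall t, Derive F t = f t) by (intros; now apply is_derive_unique).
  apply is_RInt_gen_ext_all with (Derive F); trivial.
  apply is_RInt_gen_Derive; trivial; apply filter_forall; intros ab x _.
  - eexists; apply HF.
  - apply continuous_ext with f; [intros; now rewrite E | apply Hf].
Qed.

Lemma sinh_PI_lim : is_lim (fun t => sinh (PI * t)) p_infty p_infty.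
Proof.
  apply is_lim_le_p_loc with (fun t => t); [|apply is_lim_id].
  exists 0. intros t Ht. unfold sinh. assert (HP : 2 < PI) by (generalize PI2_1; lra).
  assert (H1 := exp_ineq1_le (PI * t)).
  assert (H2 : exp (- (PI * t)) <= exp 0) by (apply exp_le_compat; nra). rewrite exp_0 in H2. nra.
Qed.

Lemma cosh_PI_lim : is_lim (fun t => cosh (PI * t)) p_infty p_infty.
Proof.
  apply is_lim_le_p_loc with (2 := sinh_PI_lim).
  exists 0. intros t _. unfold cosh, sinh. assert (H := exp_pos (- (PI * t))). lra.
Qed.

Lemma inv_lim (f : R -> R) :
  is_lim f p_infty p_infty -> filterlim (fun t => / f t) (Rbar_locally p_infty) (locally 0).
Proof. intros H. exact (is_lim_inv f p_infty p_infty H ltac:(discriminate)). Qed.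

Lemma sinh_odd (x : R) : sinh (- x) = - sinh x.
Proof. unfold sinh. rewrite Ropp_involutive. field. Qed.

Lemma cosh_even (x : R) : cosh (- x) = cosh x.
Proof. unfold cosh. rewrite Ropp_involutive. field. Qed.

Lemma cosh_ge_1 (x : R) : 1 <= cosh x.
Proof.
  unfold cosh. assert (HE : exp x * exp (- x) = 1) by (rewrite <- exp_plus, Rplus_opp_r; apply exp_0).
  assert (H := exp_pos x). assert (H' := exp_pos (- x)). 
  assert (P := Rle_0_sqr (exp x - exp (- x))). unfold Rsqr in P. nra.
Qed.

Lemma is_derive_sinh_PI (t : R) : is_derive (fun t => sinh (PI * t)) t (PI * cosh (PI * t)).
Proof. unfold sinh, cosh. auto_derive; trivial. field. Qed.

Lemma is_derive_cosh_PI (t : R) : is_derive (fun t => cosh (PI * t)) t (PI * sinh (PI * t)).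
Proof. unfold sinh, cosh. auto_derive; trivial. field. Qed.

(** The real part of [1 / sin (PI (c + it))] has antiderivative
    [atan (sinh (PI t) / sin (PI c)) / PI], with limits [-1/2] and [1/2]; the imaginary part has
    [ln ((cosh (PI t) + k) / (cosh (PI t) - k)) / (2 PI)] where [k = cos (PI c)], with both limits [0]. *)
Lemma inv_Csin_integral (c : R) :
  0 < c < 1 -> is_line_integral (fun t => / Csin (PI * (c, t)))%C 1.
Proof.
  intros Hc. assert (HP := PI_RGT_0).
  assert (Hs : 0 < sin (PI * c)) by (apply sin_gt_0; nra).
  set (k := cos (PI * c)). set (s := sin (PI * c)) in *.
  assert (Hk : k * k = 1 - s * s).
  { assert (H := sin2_cos2 (PI * c)). fold s k in H. unfold Rsqr in H. lra. }
  assert (N : forall t, 0 < s * s + sinh (PI * t) * sinh (PI * t)) by (intros; nra).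
  assert (CK : forall t, 0 < cosh (PI * t) + k /\ 0 < cosh (PI * t) - k).
  { intros t. assert (H := cosh_ge_1 (PI * t)). nra. }
  assert (E : forall t, (/ Csin (PI * (c, t)))%C =
     (s * cosh (PI * t) / (s * s + sinh (PI * t) * sinh (PI * t)),
      - (k * sinh (PI * t)) / (s * s + sinh (PI * t) * sinh (PI * t)))).
  { intros t. unfold Cinv. 
    replace (s * s + sinh (PI * t) * sinh (PI * t)) with
      (sin (PI * c) ^ 2 + sinh (PI * t) ^ 2) by (unfold s; ring).
    rewrite <- Csin_norm. rewrite Csin_PI_coord. reflexivity. }
  apply is_line_integral_ext with (1 := fun t => eq_sym (E t)).
  assert (Cont : forall (f : R -> R) t, ex_derive f t -> continuous f t).
  { intros. now apply (ex_derive_continuous (V := R_NormedModule)). }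
  split; simpl.
  - assert (L : filterlim (fun t => / PI * atan (sinh (PI * t) / s)) (Rbar_locally p_infty)
                  (locally (/ 2))).
    { (* [atan x = PI / 2 - atan (1 / x)] turns the limit at infinity into continuity at [0]. *)
      apply filterlim_ext_loc with (fun t => / PI * (PI / 2 - atan (s * / sinh (PI * t)))).
      - exists 0. intros t Ht. f_equal.
        assert (0 < sinh (PI * t)) by (rewrite <- sinh_0; apply sinh_lt; nra).
        assert (0 < sinh (PI * t) / s) by now apply Rdiv_lt_0_compat.
        replace (s * / sinh (PI * t)) with (/ (sinh (PI * t) / s)) by (field; lra).
        rewrite atan_inv by trivial. ring.
      - replace (/ 2) with (/ PI * (PI / 2 - atan (s * 0))) by (rewrite Rmult_0_r, atan_0; field; lra).
        apply (filterlim_comp _ _ _ (fun t => / sinh (PI * t))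
            (fun r => / PI * (PI / 2 - atan (s * r))) _ (locally 0)).
        + apply (inv_lim (fun t => sinh (PI * t))), sinh_PI_lim.
        + apply (Cont (fun r => / PI * (PI / 2 - atan (s * r)))). auto_derive; trivial. }
    replace 1 with (/ 2 - - / 2) by field.
    apply is_RInt_gen_antiderivative with (fun t => / PI * atan (sinh (PI * t) / s));
      try typeclasses eauto; trivial.
    + intros t. assert (HS := is_derive_sinh_PI t). specialize (N t).
      set (S := fun t => sinh (PI * t)) in *.
      change (is_derive (fun t => / PI * atan (S t / s)) t (s * cosh (PI * t) / (s * s + S t * S t))).
      change (is_derive S t (PI * cosh (PI * t))) in HS.
      change (0 < s * s + S t * S t) in N. clearbody S.
      auto_derive; [eexists; exact HS|].
      change (Derive (fun t => S t) t) with (Derive S t). rewrite (is_derive_unique _ _ _ HS).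
      field. repeat split; nra.
    + intros t. apply Cont. assert (HS := is_derive_sinh_PI t). assert (HC := is_derive_cosh_PI t).
      specialize (N t). set (S := fun t => sinh (PI * t)) in *. set (K := fun t => cosh (PI * t)) in *.
      change (ex_derive (fun t => s * K t / (s * s + S t * S t)) t).
      change (is_derive S t (PI * cosh (PI * t))) in HS.
      change (is_derive K t (PI * sinh (PI * t))) in HC.
      change (0 < s * s + S t * S t) in N. clearbody S K.
      auto_derive. repeat split; try (eexists; eassumption). lra.
    + apply filterlim_m_infty.
      apply filterlim_ext with (fun t => - (/ PI * atan (sinh (PI * t) / s))).
      * intros t. replace (PI * - t) with (- (PI * t)) by ring. rewrite sinh_odd.
        replace (- sinh (PI * t) / s) with (- (sinh (PI * t) / s)) by (field; lra).
        rewrite atan_opp. ring.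
      * apply filterlim_comp with (1 := L). apply (filterlim_Rbar_opp (/ 2)).
  - set (F := fun t => / (2 * PI) * ln ((cosh (PI * t) + k) / (cosh (PI * t) - k))).
    assert (L : filterlim F (Rbar_locally p_infty) (locally 0)).
    { apply filterlim_ext with (fun t => / (2 * PI) * ln ((1 + k * / cosh (PI * t)) / (1 - k * / cosh (PI * t)))).
      - intros t. unfold F. f_equal. f_equal. assert (H := cosh_ge_1 (PI * t)).
        destruct (CK t). field. repeat split; lra.
      - replace 0 with (/ (2 * PI) * ln ((1 + k * 0) / (1 - k * 0))) at 1.
        2: { rewrite Rmult_0_r, Rplus_0_r, Rminus_0_r, Rdiv_1_r, ln_1. ring. }
        apply (filterlim_comp _ _ _ (fun t => / cosh (PI * t))
            (fun r => / (2 * PI) * ln ((1 + k * r) / (1 - k * r))) _ (locally 0)).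
        + apply (inv_lim (fun t => cosh (PI * t))), cosh_PI_lim.
        + apply (Cont (fun r => / (2 * PI) * ln ((1 + k * r) / (1 - k * r)))).
          auto_derive. rewrite Rmult_0_r, Rplus_0_r, Ropp_0, Rplus_0_r, Rinv_1. repeat split; lra. }
    replace 0 with (0 - 0) by ring.
    apply is_RInt_gen_antiderivative with F; try typeclasses eauto; trivial.
    + intros t. assert (HC := is_derive_cosh_PI t). specialize (N t). destruct (CK t) as [C1 C2].
      assert (H := cosh_sqr (PI * t)). unfold F. set (S := sinh (PI * t)) in *.
      set (K := fun t => cosh (PI * t)) in *.
      change (is_derive (fun t => / (2 * PI) * ln ((K t + k) / (K t - k))) t (- (k * S) / (s * s + S * S))).
      change (K t * K t = 1 + S * S) in H. change (0 < K t + k) in C1. change (0 < K t - k) in C2.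
      change (is_derive K t (PI * S)) in HC.
      clearbody S K.
      replace (s * s + S * S) with ((K t + k) * (K t - k)) by lra.
      auto_derive.
      * repeat split; try (eexists; exact HC); try lra. apply Rmult_lt_0_compat; trivial.
        apply Rinv_0_lt_compat. lra.
      * change (Derive (fun t => K t) t) with (Derive K t). rewrite (is_derive_unique _ _ _ HC).
        field. repeat split; lra.
    + intros t. apply Cont. assert (HS := is_derive_sinh_PI t).
      specialize (N t). set (S := fun t => sinh (PI * t)) in *.
      change (ex_derive (fun t => - (k * S t) / (s * s + S t * S t)) t).
      change (is_derive S t (PI * cosh (PI * t))) in HS.
      change (0 < s * s + S t * S t) in N. clearbody S.
      auto_derive. repeat split; try (eexists; eassumption). lra.
    + apply filterlim_m_infty. apply filterlim_ext with F; trivial.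
      intros t. unfold F. replace (PI * - t) with (- (PI * t)) by ring. now rewrite cosh_even.
Qed.

(** * The integral of e^(lw) / sin(PI w) *)

(** Solving [(1 + e^(-l)) F = 2 F0] with [F0 = 1]: pointwise, [(1 + e^(-l)) e^(l w) / sin (PI w)]
    is the difference of [regular_quotient l] at [w] and at [w - 1] plus [2 / sin (PI w)]. *)
Lemma Cexp_over_Csin_integral (l : C) (c : R) :
  0 < c < 1 -> Rabs (Im l) < PI -> (1 + Cexp l)%C <> 0 ->
  is_line_integral (fun t => Cexp (l * (c, t)) / Csin (PI * (c, t)))%C
    (2 * Cexp l / (1 + Cexp l))%C.
Proof.
  intros Hc Hl H0.
  set (r := (Cexp l / (1 + Cexp l))%C).
  apply is_line_integral_ext with
    (fun t => r * ((regular_quotient l (c, t) - regular_quotient l ((c - 1)%R, t)) + 2 * / Csin (PI * (c, t))))%C.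
  - intros t.
    rewrite !regular_quotient_def by (apply pair_neq_0; lra).
    assert (HS : Csin (PI * (c, t)) <> 0) by (apply Csin_PI_neq_0; [simpl; lra | apply pair_neq_0; lra]).
    replace (c - 1, t) with ((c, t) - 1)%C by (apply C_ext; simpl; ring).
    rewrite Csin_PI_shift.
    replace (l * ((c, t) - 1))%C with (l * (c, t) + - l)%C by ring.
    rewrite Cexp_plus, Cexp_opp. unfold r. field. repeat split; trivial. apply Cexp_neq_0.
  - replace (2 * Cexp l / (1 + Cexp l))%C with (r * (0 + 2 * 1))%C by (unfold r; field; trivial).
    apply is_line_integral_scal, is_line_integral_plus.
    + now apply regular_quotient_shift_integral.
    + now apply is_line_integral_scal, inv_Csin_integral.
Qed.

(** * The two formulas *)

Lemma is_RInt_gen_even (f : R -> R) (l : R) :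
  (forall t, continuous f t) -> (forall t, f (- t) = f t) ->
  is_RInt_gen f (Rbar_locally m_infty) (Rbar_locally p_infty) l ->
  is_RInt_gen f (at_point 0) (Rbar_locally p_infty) (l / 2).
Proof.
  intros Hf He H P [eps HP].
  assert (Hex : forall a b, ex_RInt f a b).
  { intros a b. apply (ex_RInt_continuous (V := R_CompleteNormedModule)). auto. }
  destruct (H _ (locally_ball l eps)) as [Q1 Q2 [A HA] [B HB] HQ].
  refine (Filter_prod _ _ _ (fun a => a = 0) (fun b => Rmax (- A) B < b) _ _ _).
  - reflexivity.
  - now exists (Rmax (- A) B).
  - intros a b -> Hb.
    assert (H1 := Rmax_l (- A) B). assert (H2 := Rmax_r (- A) B).
    destruct (HQ (- b) b (HA (- b) ltac:(lra)) (HB b ltac:(lra))) as (y & Hy & By).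
    simpl in Hy. exists (RInt f 0 b). split.
    + apply (RInt_correct (V := R_CompleteNormedModule)), Hex.
    + apply HP. change (Rabs (RInt f 0 b - l / 2) < eps).
      change (Rabs (y - l) < eps) in By.
      assert (E : y = RInt f 0 b + RInt f 0 b).
      { rewrite <- (is_RInt_unique _ _ _ _ Hy).
        rewrite <- (RInt_Chasles f (- b) 0 b) by apply Hex.
        change plus with Rplus. f_equal.
        rewrite <- opp_RInt_swap by apply Hex.
        symmetry. apply is_RInt_unique.
        assert (K := RInt_correct (V := R_CompleteNormedModule) f 0 (- b) (Hex 0 (- b))).
        rewrite <- Ropp_0 in K at 1. apply is_RInt_comp_opp, is_RInt_opp in K.
        apply (is_RInt_ext (V := R_NormedModule)) with (2 := K). intros x _.
        rewrite opp_opp. apply He. }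
      rewrite E in By.
      replace (RInt f 0 b - l / 2) with ((RInt f 0 b + RInt f 0 b - l) / 2) by field.
      unfold Rdiv. rewrite Rabs_mult, (Rabs_right (/ 2)) by lra.
      assert (P0 := Rabs_pos (RInt f 0 b + RInt f 0 b - l)). lra.
Qed.

Lemma one_plus_Cexp_neq_0 (l : C) :
  0 < Rabs (Im l) < PI -> (1 + Cexp l)%C <> 0.
Proof.
  intros Hl E. 
  assert (H : exp (Re l) * sin (Im l) = 0).
  { apply (f_equal Im) in E. simpl in E. lra. }
  assert (He := exp_pos (Re l)).
  apply Rmult_integral in H as [H | H]; [lra|].
  revert Hl. unfold Rabs. destruct (Rcase_abs (Im l)); intros Hl.
  - assert (sin (Im l) < 0) by (apply sin_lt_0_var; lra). lra.
  - assert (0 < sin (Im l)) by (apply sin_gt_0; lra). lra.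
Qed.

Lemma RtoC_exp (x : R) : RtoC (exp x) = Cexp x.
Proof. unfold Cexp; simpl. rewrite cos_0, sin_0. apply C_ext; simpl; ring. Qed.

Lemma RtoC_cos (x : R) : RtoC (cos x) = ((Cexp (Ci * x) + / Cexp (Ci * x)) / 2)%C.
Proof.
  rewrite <- Cexp_opp. unfold Cexp; simpl.
  replace (0 * x - 1 * 0) with 0 by ring. replace (0 * 0 + 1 * x) with x by ring.
  rewrite Ropp_0, exp_0, cos_neg, sin_neg. apply C_ext; simpl; field.
Qed.

Lemma C2_neq_0 : RtoC 2 <> 0.
Proof. intros H; apply RtoC_inj in H; lra. Qed.

Lemma RtoC_PI_neq_0 : RtoC PI <> 0.
Proof. intros H; apply RtoC_inj in H. now apply PI_neq0. Qed.

Lemma Ci_neq_0 : Ci <> 0.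
Proof. intros H; injection H; lra. Qed.

(** Here [sin (PI (a w - b)) x^w], with [x = u^a], is a combination of [e^(l1 w)] and [e^(l2 w)]
    with [l1, l2 = ln x + i PI a, ln x - i PI a], and
    [1 + 2 x cos (PI a) + x^2 = (1 + e^l1) (1 + e^l2)]. *)
Lemma vertical_sine_quotient (a c u : R) (b : C) :
  0 < a < 1 -> 0 < c < 1 ->
  exists l : C,
    is_vertical_integral
      (fun w : C => Csin (PI * (a * w - b)) / Csin (PI * w) * Cpower (Rpower u a) w)%C c l
    /\ (1 / (2 * PI * Ci) * l =
        1 / PI *
        ((Rpower u a * Csin (PI * (a - b)) - Rpower u (2 * a) * Csin (PI * b))
         / RtoC (1 + 2 * Rpower u a * cos (PI * a) + Rpower u (2 * a))))%C.
Proof.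
  intros Ha Hc. assert (HP := PI_RGT_0).
  set (L := a * ln u).
  set (l1 := (L + Ci * (PI * a))%C). set (l2 := (L - Ci * (PI * a))%C).
  assert (I1 : Im l1 = PI * a) by (simpl; ring).
  assert (I2 : Im l2 = - (PI * a)) by (simpl; ring).
  assert (B1 : 0 < Rabs (Im l1) < PI) by (rewrite I1, Rabs_right; nra).
  assert (B2 : 0 < Rabs (Im l2) < PI) by (rewrite I2, Rabs_Ropp, Rabs_right; nra).
  assert (N1 := one_plus_Cexp_neq_0 l1 B1). assert (N2 := one_plus_Cexp_neq_0 l2 B2).
  set (be := Cexp (Ci * (PI * b))).
  assert (Hbe : be <> 0) by apply Cexp_neq_0.
  exists (Ci / (2 * Ci * be) * (2 * Cexp l1 / (1 + Cexp l1))
          + - (Ci * be / (2 * Ci)) * (2 * Cexp l2 / (1 + Cexp l2)))%C.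
  split.
  - unfold is_vertical_integral. apply is_line_integral_RInt_gen.
    apply is_line_integral_ext with
      (fun t => Ci / (2 * Ci * be) * (Cexp (l1 * (c, t)) / Csin (PI * (c, t)))
         + - (Ci * be / (2 * Ci)) * (Cexp (l2 * (c, t)) / Csin (PI * (c, t))))%C.
    + intros t. rewrite vertical_coord. set (w := (c, t)).
      assert (HS : Csin (PI * w) <> 0) by (apply Csin_PI_neq_0; [simpl; lra | apply pair_neq_0; lra]).
      unfold Cpower. unfold Rpower at 1. rewrite ln_exp. fold L.
      unfold Csin at 3. rewrite Cexp_opp.
      set (z := Cexp (Ci * (PI * (a * w)))).
      assert (Hz : z <> 0) by apply Cexp_neq_0.
      replace (Cexp (Ci * (PI * (a * w - b)))) with (z / be)%C.
      2: { unfold z, be, Cdiv. rewrite <- Cexp_opp, <- Cexp_plus. f_equal. ring. }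
      replace (Cexp (l1 * w)) with (Cexp (w * L) * z)%C.
      2: { unfold z. rewrite <- Cexp_plus. f_equal. unfold l1. ring. }
      replace (Cexp (l2 * w)) with (Cexp (w * L) / z)%C.
      2: { unfold z, Cdiv. rewrite <- Cexp_opp, <- Cexp_plus. f_equal. unfold l2. ring. }
      field. repeat split; trivial; try apply Ci_neq_0; try apply C2_neq_0.
    + apply is_line_integral_plus; apply is_line_integral_scal; apply Cexp_over_Csin_integral; trivial; lra.
  - set (x := Cexp L). set (e := Cexp (Ci * (PI * a))).
    assert (He : e <> 0) by apply Cexp_neq_0.
    assert (E1 : Cexp l1 = (x * e)%C) by apply Cexp_plus.
    assert (E2 : Cexp l2 = (x / e)%C).
    { unfold l2, Cminus, x, e. now rewrite Cexp_plus, Cexp_opp. }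
    rewrite !RtoC_plus, !RtoC_mult, RtoC_cos, RtoC_mult. fold e.
    unfold Rpower. rewrite !RtoC_exp. fold L. fold x.
    replace (Cexp (RtoC (2 * a * ln u))) with (x * x)%C.
    2: { unfold x. rewrite <- Cexp_plus, <- RtoC_plus. do 2 f_equal. unfold L. ring. }
    unfold Csin. rewrite !Cexp_opp. fold be.
    replace (Cexp (Ci * (PI * (a - b)))) with (e / be)%C.
    2: { unfold e, be, Cdiv. rewrite <- Cexp_opp, <- Cexp_plus. f_equal. ring. }
    rewrite E1 in *. rewrite E2 in *.
    (* The condition [1 + e^l2 <> 0] with denominators cleared, as [field] asks for it. *)
    assert (N2' : (e + x)%C <> 0).
    { intros H. apply N2. replace (1 + x / e)%C with ((e + x) / e)%C by (field; trivial).
      rewrite H. unfold Cdiv. ring. }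
    assert (D : (1 + 2 * x * ((e + / e) / 2) + x * x)%C = ((1 + x * e) * (1 + x / e))%C)
      by (field; trivial).
    rewrite D.
    field. repeat split; trivial; try apply Ci_neq_0; try apply C2_neq_0; try apply RtoC_PI_neq_0.
Qed.

(** On the line [Re w = 1/2], where [sin (PI w) = cosh (PI t)], the integrand is the real part of
    the average of [e^(-l/2) e^(l w) / sin (PI w)] over the two values [l = a ln u + i PI a] and
    [l = a ln u - i PI a].  These are named [2 m1] and [2 m2] below, since the result is a
    rational function of [e^m1] and [e^m2]. *)
Lemma half_line_cosh_quotient (a u : R) :
  0 < a < 1 ->
  is_RInt_gen
    (fun t : R => cosh (PI * a * t) / cosh (PI * t) * cos (a * t * ln u))
    (at_point 0) (Rbar_locally p_infty)
    (Rpower u (a / 2) * (1 + Rpower u a) * cos (PI * a / 2)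
     / (1 + 2 * Rpower u a * cos (PI * a) + Rpower u (2 * a))).
Proof.
  intros Ha. assert (HP := PI_RGT_0).
  set (L := a * ln u).
  set (m1 := ((L + Ci * (PI * a)) / 2)%C). set (m2 := ((L - Ci * (PI * a)) / 2)%C).
  assert (I1 : Im (2 * m1) = PI * a) by (simpl; field).
  assert (I2 : Im (2 * m2) = - (PI * a)) by (simpl; field).
  assert (B1 : 0 < Rabs (Im (2 * m1)) < PI) by (rewrite I1, Rabs_right; nra).
  assert (B2 : 0 < Rabs (Im (2 * m2)) < PI) by (rewrite I2, Rabs_Ropp, Rabs_right; nra).
  assert (N1 := one_plus_Cexp_neq_0 _ B1). assert (N2 := one_plus_Cexp_neq_0 _ B2).
  set (T := Rpower u (a / 2) * _ * _ / _).
  replace T with (2 * T / 2) by field.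
  apply is_RInt_gen_even.
  - intros t. apply (ex_derive_continuous (V := R_NormedModule)).
    unfold cosh. auto_derive. repeat split.
    assert (Q := exp_pos (PI * t)). assert (Q' := exp_pos (- (PI * t))). lra.
  - intros t. replace (PI * a * - t) with (- (PI * a * t)) by ring.
    replace (PI * - t) with (- (PI * t)) by ring.
    replace (a * - t * ln u) with (- (a * t * ln u)) by ring.
    now rewrite !cosh_even, cos_neg.
  - assert (Hh : 0 < / 2 < 1) by lra.
    assert (J1 := is_line_integral_scal (/ (2 * Cexp m1)) _ _
                    (Cexp_over_Csin_integral _ _ Hh (proj2 B1) N1)).
    assert (J2 := is_line_integral_scal (/ (2 * Cexp m2)) _ _
                    (Cexp_over_Csin_integral _ _ Hh (proj2 B2) N2)).
    assert (J := is_line_integral_plus _ _ _ _ J1 J2). clear J1 J2.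
    match type of J with is_line_integral _ ?v => replace v with (RtoC (2 * T)) in J end.
    + destruct J as [J _]. refine (is_RInt_gen_ext_all _ _ _ _ _ _ _ _ J).
      intros t.
      assert (X : forall m, (/ (2 * Cexp m) * (Cexp (2 * m * ((/ 2)%R, t)) / Csin (PI * ((/ 2)%R, t))))%C
                  = (Cexp (2 * (m * (Ci * t))) / (2 * cosh (PI * t)))%C).
      { intros m. rewrite Csin_PI_coord.
        replace (PI * / 2) with (PI / 2) by field. rewrite sin_PI2, cos_PI2.
        replace (1 * cosh (PI * t), 0 * sinh (PI * t)) with (RtoC (cosh (PI * t)))
          by (apply C_ext; simpl; ring).
        replace (2 * m * ((/ 2)%R, t))%C with (m + 2 * (m * (Ci * t)))%C.
        2: { replace ((/ 2)%R, t) with (/ 2 + Ci * t)%C.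
             field; apply C2_neq_0. rewrite <- RtoC_inv by lra. apply vertical_coord. }
        rewrite Cexp_plus. field. split; [|apply Cexp_neq_0].
        intros H. apply RtoC_inj in H. assert (Q := cosh_ge_1 (PI * t)). lra. }
      rewrite !X.
      assert (M1 : (2 * (m1 * (Ci * t)))%C = ((- (PI * a * t))%R, a * t * ln u)).
      { replace (2 * (m1 * (Ci * t)))%C with (Ci * t * (L + Ci * (PI * a)))%C
          by (unfold m1; field; apply C2_neq_0).
        apply C_ext; unfold L; simpl; ring. }
      assert (M2 : (2 * (m2 * (Ci * t)))%C = (PI * a * t, a * t * ln u)).
      { replace (2 * (m2 * (Ci * t)))%C with (Ci * t * (L - Ci * (PI * a)))%C
          by (unfold m2; field; apply C2_neq_0).
        apply C_ext; unfold L; simpl; ring. }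
      rewrite M1, M2.
      assert (Q := cosh_ge_1 (PI * t)).
      rewrite <- RtoC_mult. unfold Cdiv. rewrite <- RtoC_inv by lra.
      unfold Cexp; simpl. unfold cosh at 3. field. lra.
    + set (h := Cexp (L / 2)). set (e := Cexp (Ci * (PI * a / 2))).
      assert (He : e <> 0) by apply Cexp_neq_0.
      assert (E1 : Cexp m1 = (h * e)%C).
      { unfold h, e. rewrite <- Cexp_plus. f_equal. unfold m1. field; apply C2_neq_0. }
      assert (E2 : Cexp m2 = (h / e)%C).
      { unfold h, e, Cdiv. rewrite <- Cexp_opp, <- Cexp_plus. f_equal. unfold m2. field; apply C2_neq_0. }
      assert (F1 : Cexp (2 * m1) = (h * e * (h * e))%C).
      { rewrite <- E1, <- Cexp_plus. f_equal. ring. }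
      assert (F2 : Cexp (2 * m2) = (h / e * (h / e))%C).
      { rewrite <- E2, <- Cexp_plus. f_equal. ring. }
      rewrite F1 in *. rewrite F2 in *. rewrite E1, E2.
      assert (Hhh : h <> 0) by apply Cexp_neq_0.
      assert (X1 : RtoC (Rpower u (a / 2)) = h).
      { unfold Rpower. rewrite RtoC_exp. unfold h, L. f_equal.
        replace (a / 2 * ln u) with (a * ln u / 2) by field.
        rewrite RtoC_div by lra. reflexivity. }
      assert (X2 : RtoC (Rpower u a) = (h * h)%C).
      { rewrite <- X1, <- RtoC_mult, <- Rpower_plus. do 2 f_equal. field. }
      assert (X4 : RtoC (Rpower u (2 * a)) = (h * h * (h * h))%C).
      { rewrite <- X2, <- RtoC_mult, <- Rpower_plus. do 2 f_equal. ring. }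
      assert (Y1 : RtoC (cos (PI * a / 2)) = ((e + / e) / 2)%C).
      { rewrite RtoC_cos. unfold e. rewrite RtoC_div, RtoC_mult by lra. reflexivity. }
      assert (Y2 : RtoC (cos (PI * a)) = ((e * e + / (e * e)) / 2)%C).
      { rewrite RtoC_cos. unfold e. rewrite <- Cexp_plus, RtoC_mult.
        replace (Ci * (PI * a / 2) + Ci * (PI * a / 2))%C with (Ci * (PI * a))%C
          by (field; apply C2_neq_0). reflexivity. }
      assert (D : RtoC (1 + 2 * Rpower u a * cos (PI * a) + Rpower u (2 * a))
                  = ((1 + h * e * (h * e)) * (1 + h / e * (h / e)))%C).
      { rewrite !RtoC_plus, !RtoC_mult, X2, X4, Y2. field. trivial. }
      assert (D0 : 1 + 2 * Rpower u a * cos (PI * a) + Rpower u (2 * a) <> 0).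
      { intros H. rewrite H in D. symmetry in D. revert D. now apply Cmult_neq_0. }
      unfold T. rewrite RtoC_mult, RtoC_div by trivial. rewrite D, !RtoC_mult, RtoC_plus, X1, X2, Y1.
      assert (N2' : (e * e + h * h)%C <> 0).
      { intros H. apply N2. replace (1 + h / e * (h / e))%C with ((e * e + h * h) / (e * e))%C
          by (field; trivial). rewrite H. unfold Cdiv. ring. }
      field. repeat split; trivial; try apply C2_neq_0.
Qed.

Theorem mainTheorem15 :
  forall (a c : R) (b : C) (u : R),
    (0 < a < 1)%R -> (0 < c < 1)%R -> (0 < u)%R ->
    (exists l : C,
        is_vertical_integral
          (fun w : C =>
             Csin (PI * (a * w - b)) / Csin (PI * w) * Cpower (Rpower u a) w)%C
          c l
        /\ (1 / (2 * PI * Ci) * l =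
            1 / PI *
            ((Rpower u a * Csin (PI * (a - b))
              - Rpower u (2 * a) * Csin (PI * b))
             / RtoC (1 + 2 * Rpower u a * cos (PI * a) + Rpower u (2 * a))))%C)
    /\
    is_RInt_gen
      (fun t : R =>
         cosh (PI * a * t) / cosh (PI * t) * cos (a * t * ln u))%R
      (at_point 0) (Rbar_locally p_infty)
      (Rpower u (a / 2) * (1 + Rpower u a) * cos (PI * a / 2)
       / (1 + 2 * Rpower u a * cos (PI * a) + Rpower u (2 * a)))%R.
Proof.
  intros a c b u Ha Hc _. split.
  - exact (vertical_sine_quotient a c u b Ha Hc).
  - exact (half_line_cosh_quotient a u Ha).
Qed.
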